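(* Let $T(x)=1+\sum_{n\ge1} t_n x^n$ be the formal power series defined in the context (the cluster generating function for the consecutive pattern $1423$), which satisfies \[T(x) = 1 + \frac{x}{1+x}\,T\!\left(\frac{x}{1+x^2}\right).\] Let $B(x)=\frac{x}{1+x^2}$, $B_0(x)=x$ and $B_j(x)=B(B_{j-1}(x))$ for $j\ge1$. Then this functional equation has the solution \[T(x) = 1 + \sum_{n=0}^\infty \prod_{j=0}^n \frac{B_j(x)}{1+B_j(x)},\] where the infinite sum converges in the ring of formal power series in $x$.
   Context: Let $\sigma=1423$, a consecutive pattern of length $m=4$. An occurrence of $\sigma$ in a permutation $\pi=\pi_1\cdots\pi_n$ is a set of $m$ consecutive positions whose entries are in the same relative order as $\sigma$. A $k$-cluster of length $n\ge m$ is a permutation $\pi$ of $\{1,\dots,n\}$ such that $\pi$ contains precisely $k$ occurrences of $\sigma$, every entry of $\pi$ belongs to at least one occurrence of $\sigma$, and any two successive occurrences of $\sigma$ overlap in at least one position. Let $s_{n,k}$ be the number of $k$-clusters of length $n$, with the additional convention $s_{1,0}=1$ (and $s_{n,k}=0$ for all other $n<m$). Set $t_n=\sum_k (-1)^k s_{n,k}$ and $T(x)=1+\sum_{n\ge1} t_n x^n$. *)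

(* Defs.v *)
From mathcomp Require Import all_boot all_order all_algebra perm.
Set Implicit Arguments. Unset Strict Implicit. Unset Printing Implicit Defensive.
Import GRing.Theory Num.Theory.
Local Open Scope ring_scope.

Definition sigma1423 : seq nat := [:: 1; 4; 2; 3]%N.

Section Clusters.
Variable sigma : seq nat.
Local Notation m := (size sigma).

Definition pseq n (pi : 'S_n) : seq nat := [seq val (pi x) | x <- enum 'I_n].

Definition occ_at (s : seq nat) (i : nat) : bool :=
  (i + m <= size s)%N &&
  [forall a : 'I_m, forall b : 'I_m,
     (nth 0 sigma a < nth 0 sigma b)%N == (nth 0 s (i + a) < nth 0 s (i + b))%N].

Definition occs (s : seq nat) : seq nat := [seq i <- iota 0 (size s) | occ_at s i].

Definition is_cluster (s : seq nat) : bool :=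
  all (fun p => has (fun i => (i <= p < i + m)%N) (occs s)) (iota 0 (size s)) &&
  all (fun i => all (fun j =>
        ((i < j)%N && ~~ has (fun l => (i < l < j)%N) (occs s)) ==> (j < i + m)%N)
      (occs s)) (occs s).

Definition s_nk (n k : nat) : nat :=
  if (n < m)%N then ((n == 1%N) && (k == 0%N) : nat)
  else #|[set pi : 'S_n | is_cluster (pseq pi) && (size (occs (pseq pi)) == k)]|.

(* t_n = sum_k (-1)^k s_{n,k}; s_{n,k} = 0 for k > n (at most n occurrences) *)
Definition t_n (n : nat) : int := \sum_(k < n.+1) (-1) ^+ k * (s_nk n k)%:Z.

Definition Tcoef (n : nat) : int := if n == 0%N then 1 else t_n n.
End Clusters.

Definition fps := nat -> int.

Definition fone : fps := fun n => (n == 0%N)%:R.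
Definition fX : fps := fun n => (n == 1%N)%:R.
Definition fadd (f g : fps) : fps := fun n => f n + g n.
Definition fmul (f g : fps) : fps := fun n => \sum_(i < n.+1) f i * g (n - i)%N.
Fixpoint fpow (f : fps) (k : nat) : fps :=
  if k is k'.+1 then fmul f (fpow f k') else fone.
(* 1/(1+f) for f with zero constant term: sum_k (-f)^k *)
Definition finv1 (f : fps) : fps :=
  fun n => \sum_(k < n.+1) (-1) ^+ k * fpow f k n.
(* composition g(f) for f with zero constant term: sum_k g_k f^k *)
Definition fcomp (g f : fps) : fps :=
  fun n => \sum_(k < n.+1) g k * fpow f k n.

Definition Bser : fps := fmul fX (finv1 (fpow fX 2)).
Fixpoint Bj (j : nat) : fps := if j is j'.+1 then fcomp Bser (Bj j') else fX.
Definition term (n : nat) : fps :=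
  \big[fmul/fone]_(j < n.+1) fmul (Bj j) (finv1 (Bj j)).

(* Main.v *)
(** Successive occurrences of 1423 in a cluster are at distance 2 or 3, so the sign
  of a cluster is a product computed by peeling off its first occurrence
  [a b c d]: what remains starts at [c] or at [d].  Its first entry is the
  minimum, and the second entry is only constrained to exceed the second entry
  (distance 2) or the first entry (distance 3) of what remains.  Recording the
  second entry therefore gives a recurrence, whose solution reads
  [t_n = \sum_(r >= 1) (-1)^r C(n-r-2, r) t_(n-2r-1)] for [n >= 2].  As
  [B^k = x^k (1 + x^2)^-k], this says [(1 + x) T = 1 + x + x T(B)].  Substituting
  [B_k] for [x] gives [T(B_k) = 1 + B_k / (1 + B_k) * T(B_(k+1))]; iterating [M+1]
  times leaves a remainder divisible by [x^(M+1)]. *)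
Require Import Defs.
From mathcomp Require Import all_boot all_order all_algebra perm.
From HB Require Import structures.
From mathcomp Require Import boolp zify ring.
Import GRing.Theory Num.Theory.
Local Open Scope ring_scope.
Set Implicit Arguments. Unset Strict Implicit. Unset Printing Implicit Defensive.

(** * Signed count of clusters *)

(* [(-1)^k] if [s] is a [k]-cluster or has size 1 (then [k = 0]), and 0 otherwise
   (see [weight_cluster]).  At most one of the two recursive calls is nonzero. *)
Fixpoint weight (s : seq nat) : int :=
  match s with
  | [:: _] => 1
  | a :: (b :: (c :: ((d :: _) as s3)) as s2) =>
    if [&& a < c, c < d & d < b]%N then - (weight s2 + weight s3) else 0
  | _ => 0
  end.

Arguments weight : simpl never.

Lemma weightE a b c d s : weight [:: a, b, c, d & s] =
  if [&& a < c, c < d & d < b]%N then - (weight [:: c, d & s] + weight (d :: s)) else 0.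
Proof. by []. Qed.

Lemma weight_map (h : nat -> nat) s : {mono h : x y / (x < y)%N} ->
  weight (map h s) = weight s.
Proof.
move=> hmono; have [n] := ubnP (size s); elim: n s => // n IHn.
case=> [|a [|b [|c [|d s]]]] // le_sn; rewrite 4!map_cons !weightE !hmono.
by rewrite -(IHn [:: c, d & s]) -?(IHn (d :: s)) //=; rewrite /= in le_sn; lia.
Qed.

Lemma weight_min a s x : weight (a :: s) != 0 -> x \in s -> (a < x)%N.
Proof.
have [n] := ubnP (size s); elim: n a s x => // n IHn a.
case=> [|b [|c [|d s]]] // x le_sn; rewrite weightE.
case: ifP => [/and3P[ac cd db]|_]; last by rewrite eqxx.
have ad := ltn_trans ac cd.
rewrite oppr_eq0 => nz; rewrite !inE => /or4P[/eqP->|/eqP->|/eqP->|xs] //.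
  exact: ltn_trans db.
have [w0|w0] := eqVneq (weight (d :: s)) 0.
  rewrite w0 addr0 in nz.
  by apply: ltn_trans ac _; apply: (IHn c (d :: s)); rewrite // ?inE ?xs ?orbT // /= in le_sn *; lia.
by apply: ltn_trans ad _; apply: (IHn d s) => //; rewrite /= in le_sn; lia.
Qed.

Lemma big_permutations_cons (R : nmodType) (A : seq nat) (F : seq nat -> R) :
  uniq A -> A != [::] ->
  \sum_(s <- permutations A) F s =
    \sum_(x <- A) \sum_(s <- permutations (rem x A)) F (x :: s).
Proof.
move=> uA nA; have sA : (0 < size A)%N by case: A nA {uA}.
rewrite (perm_big _ (permutationsE sA)) /= big_allpairs_dep.
by rewrite undup_id.
Qed.

Lemma big_permutations_map (R : nmodType) (h : nat -> nat) (A B : seq nat) (F : seq nat -> R) :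
  injective h -> perm_eq B (map h A) -> uniq A ->
  \sum_(s <- permutations B) F s = \sum_(s <- permutations A) F (map h s).
Proof.
move=> hI eqB uA; rewrite -(big_map (map h) predT F); apply: perm_big.
have uB : uniq B by rewrite (perm_uniq eqB) map_inj_uniq.
have uM : uniq (map (map h) (permutations A)).
  by rewrite map_inj_uniq ?permutations_uniq //; apply: inj_map.
rewrite perm_sym; apply: uniq_perm; rewrite ?permutations_uniq //.
apply: (fun H1 H2 => (uniq_min_size uM H1 H2).2) => // [_ /mapP[t tA ->]|].
  rewrite mem_permutations in tA; rewrite mem_permutations.
  by apply: perm_trans (perm_map h tA) _; rewrite perm_sym.
by rewrite size_map !size_permutations // (perm_size eqB) size_map.
Qed.

Definition weight_total (n : nat) : int := \sum_(s <- permutations (iota 0 n)) weight s.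

(* The guard [1 < n] discards the junk value of [nth 0 s 1]. *)
Definition weight_below (n v : nat) : int :=
  \sum_(s <- permutations (iota 0 n) | ((1 < n) && (nth 0 s 1 < v))%N) weight s.

Lemma weight_total0 : weight_total 0 = 0.
Proof. by rewrite /weight_total (perm_big [:: [::]]) // big_seq1. Qed.

Lemma weight_below0 n : weight_below n 0 = 0.
Proof. by rewrite /weight_below big1 // => s; rewrite ltn0 andbF. Qed.

Lemma weight_below_total n : (1 < n)%N -> weight_below n n = weight_total n.
Proof.
move=> n1; rewrite /weight_below n1 big_seq_cond [RHS]big_seq.
apply: eq_bigl => s; rewrite mem_permutations; case eqs: (perm_eq s _) => //=.
have : nth 0%N s 1 \in iota 0 n by rewrite -(perm_mem eqs) mem_nth // (perm_size eqs) size_iota.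
by rewrite mem_iota => /andP[].
Qed.

Lemma big_permutations_head (R : nmodType) (a : nat) (A : seq nat) (F : seq nat -> R) :
  uniq (a :: A) -> all (ltn a) A ->
  (forall x y s, y \in s -> (y < x)%N -> F (x :: s) = 0) ->
  \sum_(s <- permutations (a :: A)) F s = \sum_(s <- permutations A) F (a :: s).
Proof.
move=> uA /allP aA F0; rewrite big_permutations_cons // big_cons /= eqxx.
rewrite [X in _ + X]big_seq [X in _ + X]big1 ?addr0 // => x xA.
have ne_ax : (a == x) = false by apply: ltn_eqF; apply: aA.
rewrite big_seq big1 // => s; rewrite mem_permutations ne_ax => eqs.
by apply: (F0 _ a); [rewrite (perm_mem eqs) mem_head | apply: aA].
Qed.

Lemma weight_not_head x y s : y \in s -> (y < x)%N -> weight (x :: s) = 0.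
Proof.
move=> ys lt_yx; apply/eqP; apply: contraTT lt_yx => /weight_min/(_ ys).
by rewrite -leqNgt; apply: ltnW.
Qed.

Lemma weight_below_rec m v : (v < m.+3)%N ->
  weight_below m.+3 v.+1 = weight_below m.+3 v
    - (if (2 < v)%N then weight_total m else 0) - weight_below m.+1 v.-1.
Proof.
move=> lt_v.
transitivity (weight_below m.+3 v +
    \sum_(s <- permutations (iota 0 m.+3) | nth 0%N s 1 == v) weight s).
  rewrite /weight_below (bigID (fun s => nth 0 s 1 < v)%N) /=.
  by congr (_ + _); apply: eq_bigl => s; lia.
rewrite -addrA; congr (_ + _).
have [->|v_gt0] := posnP v.
  rewrite weight_below0 subr0 ltn0 oppr0 big_seq_cond big1 // => s /andP[].
  rewrite mem_permutations => eqs /eqP; move: (perm_uniq eqs) (perm_size eqs).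
  rewrite iota_uniq size_iota; case: s {eqs} => [|x [|y s]] //= us _ y0.
  apply: (@weight_not_head _ y); rewrite ?mem_head // y0 lt0n; apply/eqP => x0.
  by rewrite x0 y0 mem_head in us.
pose h x := bump v x.+1.
have hmono : {mono h : x y / (x < y)%N} by move=> x y; rewrite /h !ltnNge leq_bump2.
have hI : injective h by move=> x y /(can_inj (bumpK v)) [].
have iotaE : iota 0 m.+3 = 0%N :: iota 1 m.+2 by [].
rewrite iotaE big_mkcond big_permutations_head; first last.
- move=> x y s ys yx; rewrite (weight_not_head ys yx); exact: if_same.
- by apply/allP => x; rewrite mem_iota => /andP[].
- by rewrite -iotaE iota_uniq.
rewrite big_permutations_cons ?iota_uniq //.
have vA : v \in iota 1 m.+2 by rewrite mem_iota v_gt0.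
rewrite (bigD1_seq v) ?iota_uniq // [X in _ + X = _]big1 ?addr0; last first.
  by move=> x ne_xv; rewrite big1 // => s _ /=; rewrite (negbTE ne_xv).
rewrite (eq_bigr (fun s => weight [:: 0%N, v & s])); last by move=> s _ /=; rewrite eqxx.
rewrite (@big_permutations_map _ h (iota 0 m.+1)) ?iota_uniq //; last first.
  apply: uniq_perm; rewrite ?rem_uniq ?map_inj_uniq ?iota_uniq // => x.
  rewrite mem_rem_uniq ?iota_uniq //.
  rewrite [LHS](_ : _ = (x != v) && (x \in iota 1 m.+2)) // mem_iota.
  apply/idP/mapP => [|[y]].
    move=> /andP[ne_xv lt_x]; exists (unbump v x).-1.
      by rewrite mem_iota /unbump; lia.
    by rewrite /h /bump /unbump; lia.
  by rewrite mem_iota => lt_y ->; rewrite /h /bump; lia.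
pose C (s : seq nat) := [&& 0 < m, nth 0 s 0 < nth 0 s 1 & nth 0 s 1 < v.-1]%N.
transitivity (\sum_(s <- permutations (iota 0 m.+1))
    - ((if C s then weight s else 0) + (if C s then weight (behead s) else 0))).
  rewrite big_seq [RHS]big_seq; apply: eq_bigr => s; rewrite mem_permutations => /perm_size.
  rewrite size_iota /C; case: s => [|c [|d s]] //= [].
    by move <-; rewrite addr0 oppr0.
  move <-; rewrite weightE -(weight_map (d :: s) hmono).
  rewrite -(weight_map [:: c, d & s] hmono) hmono !map_cons.
  have -> : (0 < h c)%N by rewrite /h /bump; lia.
  have -> : (h d < v)%N = (d < v.-1)%N by rewrite /h /bump; lia.
  by case: ifP => //; rewrite addr0 oppr0.
rewrite sumrN -opprD; congr (- _); rewrite big_split [LHS]addrC; congr (_ + _); last first.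
  rewrite /weight_below [RHS]big_mkcond big_seq [RHS]big_seq; apply: eq_bigr => s.
  rewrite mem_permutations => /perm_size; rewrite size_iota /C.
  case: s => [|c [|d s]] //= [] <- //=.
  have [->|/weight_min/(_ (mem_head _ _)) ->//] := eqVneq (weight [:: c, d & s]) 0.
  by rewrite !if_same.
have [m0|m_gt0] := posnP m.
  by rewrite big1 => [|s _]; rewrite /C m0 ?weight_total0 ?if_same.
have iotaE1 : iota 0 m.+1 = 0%N :: iota 1 m by [].
rewrite iotaE1 big_permutations_head; first last.
- case=> // x y s; rewrite /C /=; case: s => [|d s] //= ys lt_yx.
  case: ifP => // /and3P[_ lt_xd _]; move: ys; rewrite inE => /predU1P[eq_yd|ys].
    by rewrite eq_yd ltnNge ltnW in lt_yx.
  by apply: weight_not_head ys _; apply: ltn_trans lt_yx lt_xd.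
- by apply/allP => x; rewrite mem_iota => /andP[].
- exact: (iota_uniq 0 m.+1).
rewrite (@big_permutations_map _ S (iota 0 m)) ?iota_uniq //; first last.
- by rewrite (iotaDl 1).
- exact: succn_inj.
transitivity (\sum_(s <- permutations (iota 0 m)) if (2 < v)%N then weight s else 0); last first.
  by case: ifP => // _; rewrite big1.
rewrite big_seq [RHS]big_seq; apply: eq_bigr => s; rewrite mem_permutations => eqs.
rewrite weight_map //; case: s eqs => [|c s] eqs; first by case: ifP; case: ifP.
have : 0%N \in c :: s by rewrite (perm_mem eqs) mem_iota.
rewrite inE => /predU1P[<-|s0]; rewrite /C m_gt0 /=.
  by congr (if _ then _ else _); lia.
case: (posnP c) => [->|c_gt0]; first by congr (if _ then _ else _); lia.
by rewrite (weight_not_head s0) ?if_same.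
Qed.

Lemma weight_below_small n v : (n <= 2)%N -> weight_below n v = 0.
Proof.
move=> le_n2; rewrite /weight_below big_seq_cond big1 // => s /andP[+ /andP[n_gt1 _]].
have {le_n2 n_gt1} -> : n = 2%N by lia.
by rewrite mem_permutations => /perm_size; case: s => [|a [|b [|c s]]].
Qed.

Lemma weight_belowE n v K : (v <= n)%N -> (n <= K)%N -> weight_below n v =
  \sum_(r < K) (-1) ^+ r.+1 * (weight_total (n - r.*2 - 3) * 'C(v - r - 3, r.+1)%:Z).
Proof.
have [k] := ubnP n; elim: k n v K => // k IHn n v K lt_nk le_vn le_nK.
have [n2|n_gt2] := leqP n 2.
  rewrite weight_below_small // big1 // => r _.
  have -> : (n - r.*2 - 3 = 0)%N by lia.
  by rewrite weight_total0 mul0r mulr0.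
case: n n_gt2 => [|[|[|m]]] // _ in lt_nk le_vn le_nK *.
case: K => // K in le_nK *; elim: v => [|v IHv] in le_vn *.
  rewrite weight_below0 big1 // => r _.
  by rewrite bin_small ?mulr0.
rewrite weight_below_rec // (IHv (ltnW le_vn)).
rewrite (IHn m.+1 v.-1 K); [|lia..].
have Em : (m.+3 - 3 = m)%N by lia.
rewrite !big_ord_recl /= !expr1 !mulN1r !subn0 Em.
rewrite !bin1 -addrA addrACA; congr (_ + _).
  case: ltnP => v2; last by rewrite subr0 (_ : v.+1 - 3 = v - 3)%N //; lia.
  by rewrite (_ : v.+1 - 3 = (v - 3).+1)%N; [rewrite intS; ring | lia].
rewrite -sumrB; apply: eq_bigr => r _; rewrite /bump add1n.
rewrite (_ : m.+3 - r.+1.*2 - 3 = m.+1 - r.*2 - 3)%N; last by lia.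
rewrite (_ : v.-1 - r - 3 = v - r.+1 - 3)%N; last by lia.
have [v3|lt_v] := leqP (r + 4) v.
  rewrite (_ : v.+1 - r.+1 - 3 = (v - r.+1 - 3).+1)%N; last by lia.
  by rewrite binS PoszD exprS; ring.
rewrite (_ : v - r.+1 - 3 = 0)%N; last by lia.
rewrite (_ : v.+1 - r.+1 - 3 = 0)%N; last by lia.
by rewrite !bin0n !mulr0 subr0.
Qed.

Lemma weight_total_rec n : weight_total n.+2 =
  \sum_(r < n.+2) (-1) ^+ r.+1 * (weight_total (n.+1 - r.+1.*2) * 'C(n.+1 - r.+1 - 1, r.+1)%:Z).
Proof.
rewrite -weight_below_total // (@weight_belowE _ _ n.+2) //; apply: eq_bigr => r _.
by congr (_ * (weight_total _ * 'C(_, _)%:Z)); lia.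
Qed.

(** * Clusters as chains of occurrences *)

Definition near : rel nat := fun i j => (j < i + 4)%N.

(* [l] is the list of occurrences of a cluster of size [n]. *)
Definition chain (n : nat) (l : seq nat) : bool :=
  if l is 0%N :: l' then path near 0 l' && (last 0 l' + 4 == n)%N else false.

Lemma path_near_cover x l p : path near x l -> (x <= p < last x l + 4)%N ->
  has (fun i => (i <= p < i + 4)%N) (x :: l).
Proof.
elim: l x => [|y l IHl] x /=; first by rewrite orbF.
case/andP=> xy yl /andP[xp pl]; rewrite xp /=; case: ltnP => //= le_p.
by apply: IHl => //; rewrite pl andbT (leq_trans _ le_p) // ltnW.
Qed.

Lemma path_ltn_last x l i : path ltn x l -> i \in x :: l -> (i <= last x l)%N.
Proof.
elim: l x i => [|y l IHl] x i /=; first by rewrite inE => _ /eqP->.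
move=> /andP[lt_xy sl]; rewrite inE => /predU1P[->|]; last exact: IHl.
by apply: leq_trans (ltnW lt_xy) _; apply: IHl; rewrite ?mem_head.
Qed.

Lemma path_nearP x l : path ltn x l ->
  path near x l = all (fun i => all (fun j =>
     ((i < j)%N && ~~ has (fun k => (i < k < j)%N) (x :: l)) ==> near i j) (x :: l)) (x :: l).
Proof.
elim: l x => [|y l IHl] x; first by rewrite /= ltnn.
move=> /andP[lt_xy' sl]; have lt_xy : (x < y)%N := lt_xy'.
rewrite [path near _ _]/= IHl //.
have yl : all (ltn y) l := order_path_min ltn_trans sl.
have ly z : z \in y :: l -> (y <= z)%N.
  by rewrite inE => /predU1P[-> //|zl]; apply: ltnW; apply: (allP yl).
apply/idP/idP.
  move=> /andP[nxy /allP H]; apply/allP => i il; apply/allP => j jl.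
  apply/implyP => /andP[lt_ij /hasPn nb].
  have jl' : j \in y :: l.
    move: jl; rewrite inE => /predU1P[jx|//]; subst j.
    move: il; rewrite inE => /predU1P[ix|/ly]; last by lia.
    by rewrite ix ltnn in lt_ij.
  move: il; rewrite inE => /predU1P[ix|il].
    subst i; have := nb y; rewrite !inE eqxx orbT => /(_ isT); rewrite lt_xy /= -leqNgt.
    by move=> le_jy; rewrite /near; apply: leq_ltn_trans le_jy nxy.
  move: (H i il) => /allP/(_ j jl')/implyP; apply; rewrite lt_ij; apply/hasPn => k kl.
  by apply: nb; rewrite inE kl orbT.
move=> /allP H; apply/andP; split.
  have /H/allP/(_ y) : x \in [:: x, y & l] by rewrite mem_head.
  rewrite !inE eqxx orbT => /(_ isT)/implyP; apply; rewrite lt_xy; apply/hasPn => k.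
  by rewrite inE => /predU1P[->|/ly]; lia.
apply/allP => i il; apply/allP => j jl; apply/implyP => /andP[lt_ij /hasPn nb].
have /H/allP/(_ j) : i \in [:: x, y & l] by rewrite inE il orbT.
rewrite inE jl orbT => /(_ isT)/implyP; apply; rewrite lt_ij; apply/hasPn => k.
rewrite inE => /predU1P[->|/nb //]; by have := ly _ il; lia.
Qed.

Lemma occs_cons sigma x s : occs sigma (x :: s) =
  (if occ_at sigma (x :: s) 0 then cons 0%N else id) (map S (occs sigma s)).
Proof.
rewrite /occs /= (iotaDl 1 0) filter_map.
have -> : filter (preim (addn 1) (occ_at sigma (x :: s))) (iota 0 (size s)) =
  filter (occ_at sigma s) (iota 0 (size s)) by apply: eq_filter.
by case: ifP.
Qed.

Lemma occ_at1423 a b c d s :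
  occ_at sigma1423 [:: a, b, c, d & s] 0 = [&& a < c, c < d & d < b]%N.
Proof.
rewrite /occ_at /=; apply/forallP/and3P => [H|[ac cd db] i].
  have Hij (i j : 'I_4) := eqP (forallP (H i) j).
  have := (Hij (inord 0) (inord 2), Hij (inord 2) (inord 3), Hij (inord 3) (inord 1)).
  by rewrite !add0n !inordK //= => -[[<- <-] <-].
apply/forallP => j; case: i j => [[|[|[|[|i]]]] // ?] [[|[|[|[|j]]]] // ?] /=; lia.
Qed.

Lemma occs_short sigma s : (size s < size sigma)%N -> occs sigma s = [::].
Proof.
move=> lt_s; apply/eqP; rewrite -size_eq0 size_filter; apply/eqP.
rewrite (@eq_count _ _ pred0) ?count_pred0 // => i.
by rewrite /occ_at leqNgt (leq_trans lt_s) ?leq_addl.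
Qed.

Lemma is_clusterE s : (0 < size s)%N ->
  is_cluster sigma1423 s = chain (size s) (occs sigma1423 s).
Proof.
set n := size s => n_gt0; rewrite /is_cluster -/n.
have : sorted ltn (occs sigma1423 s).
  by exact: (sorted_filter ltn_trans _ (iota_ltn_sorted _ _)).
have : all (fun i => i + 4 <= n)%N (occs sigma1423 s).
  by apply/allP => i; rewrite mem_filter => /andP[/andP[]].
have in0n : 0%N \in iota 0 n by rewrite mem_iota.
case: (occs sigma1423 s) => [|[|x] l]; first by case: n n_gt0 in0n.
  move=> bl sl; rewrite [X in _ && X](_ : _ = path near 0 l); last by rewrite path_nearP.
  rewrite andbC /chain; have [nl|//] := boolP (path near 0 l); rewrite !andTb.
  apply/allP/eqP => [cov|<- p]; last first.
    by rewrite mem_iota => pn; apply: path_near_cover.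
  have /cov/hasP[i il /andP[_]] : n.-1 \in iota 0 n by rewrite mem_iota; lia.
  have le_i := path_ltn_last sl il.
  have : (last 0 l + 4 <= n)%N by apply: (allP bl _ (mem_last 0 l)).
  by move: le_i n_gt0; rewrite /=; lia.
move=> bl sl; apply/negbTE; apply/nandP; left; apply/allPn; exists 0%N => //.
apply/hasPn => i; rewrite leqn0 inE => /predU1P[->//|].
by move/(allP (order_path_min ltn_trans sl)) => /=; case: i.
Qed.

Lemma path_nearS x l : path near x.+1 (map S l) = path near x l.
Proof. by rewrite path_map; apply: eq_path => i j /=. Qed.

Lemma chain_cons2 n l :
  chain n.+2 (0%N :: map S (map S (0%N :: l))) = chain n (0%N :: l).
Proof. by rewrite /= !path_nearS !last_map. Qed.

Lemma chain_cons3 n l :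
  chain n.+3 (0%N :: map S (map S (map S (0%N :: l)))) = chain n (0%N :: l).
Proof. by rewrite /= !path_nearS !last_map. Qed.

Lemma weight_cluster s : (1 < size s)%N -> weight s =
  if is_cluster sigma1423 s then (-1) ^+ size (occs sigma1423 s) else 0.
Proof.
have [n] := ubnP (size s); elim: n s => // n IHn s lt_sn s_gt1.
rewrite is_clusterE; last by lia.
have [s_lt4|] := ltnP (size s) 4.
  by rewrite occs_short //; case: s s_lt4 s_gt1 {lt_sn} => [|? [|? [|? [|? ?]]]].
case: s lt_sn s_gt1 => [|a [|b [|c [|d s]]]] // lt_sn _ _.
rewrite weightE; case: ifP => o0; last first.
  by rewrite occs_cons occ_at1423 o0 /=; case: (occs _ _).
have /and3P[ac cd db] := o0.
have o1 : occ_at sigma1423 [:: b, c, d & s] 0 = false.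
  by case: s {lt_sn} => [|e s] //; rewrite occ_at1423 (leq_gtF (ltnW db)).
rewrite 2!occs_cons occ_at1423 o0 o1.
case: s => [|e s] in lt_sn o0 o1 *; first by rewrite occs_short.
rewrite !IHn; [|move: lt_sn; rewrite /=; lia..].
rewrite !is_clusterE //.
set L' := occs _ [:: d, e & s].
rewrite [in occs _ [:: c, d, e & s]]occs_cons -/L'.
have [o2|o2] := boolP (occ_at sigma1423 [:: c, d, e & s] 0).
  have -> : chain (size [:: d, e & s]) L' = false.
    case: s o2 {lt_sn o0 o1} @L' => [|f s] // o2 L'; rewrite /L' occs_cons.
    move: o2; rewrite occ_at1423 => /and3P[_ _ /ltnW/leq_gtF fd].
    have -> : occ_at sigma1423 [:: d, e, f & s] 0 = false.
      by case: s {L'} => [|g s] //; rewrite occ_at1423 fd.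
    by case: (occs _ _).
  rewrite addr0 -[size [:: a, b & _]]/(size [:: c, d, e & s]).+2 chain_cons2.
  by case: ifP => _; rewrite ?oppr0 //= !size_map [RHS]exprS mulN1r.
have -> : chain (size [:: c, d, e & s]) (map S L') = false by case: L'.
rewrite add0r -[size [:: a, b, c & _]]/(size [:: d, e & s]).+3.
case: L' => [|[|j] l]; [| | by rewrite oppr0].
  by rewrite oppr0.
rewrite chain_cons3; case: ifP => _; rewrite ?oppr0 //=.
by rewrite !size_map [RHS]exprS mulN1r.
Qed.

Lemma pseq_perm n (pi : 'S_n) : perm_eq (pseq pi) (iota 0 n).
Proof.
rewrite /pseq map_comp -val_enum_ord; apply: perm_map.
apply: uniq_perm; rewrite ?(map_inj_uniq (@perm_inj _ pi)) ?enum_uniq //.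
by move=> i; rewrite mem_enum; apply/mapP; exists (pi^-1%g i); rewrite ?mem_enum ?permKV.
Qed.

Lemma pseq_inj n : injective (@pseq n).
Proof.
move=> p q /eq_in_map pq; apply/permP => i; apply: val_inj.
by apply: pq; rewrite mem_enum.
Qed.

Lemma big_pseq (R : nmodType) n (F : seq nat -> R) :
  \sum_(pi : 'S_n) F (pseq pi) = \sum_(s <- permutations (iota 0 n)) F s.
Proof.
rewrite -big_enum -(big_map (@pseq n) predT F); apply: perm_big.
have uM : uniq (map (@pseq n) (enum 'S_n)).
  by rewrite map_inj_uniq ?enum_uniq //; apply: pseq_inj.
apply: uniq_perm; rewrite ?permutations_uniq //.
apply: (fun H1 H2 => (uniq_min_size uM H1 H2).2) => [_ /mapP[pi _ ->]|].
  by rewrite mem_permutations pseq_perm.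
by rewrite size_map size_permutations ?iota_uniq // size_iota -cardE card_Sn.
Qed.

Lemma weight_total1 : weight_total 1 = 1.
Proof. by rewrite /weight_total (perm_big [:: [:: 0%N]]) // big_seq1. Qed.

Lemma Tcoef_weight n : (0 < n)%N -> Tcoef sigma1423 n = weight_total n.
Proof.
case: n => // n _; rewrite /Tcoef /= /t_n /s_nk.
have [lt_n4|le_4n] := ltnP n.+1 (size sigma1423).
  case: n lt_n4 => [|n] lt_n4; first by rewrite weight_total1 !big_ord_recr big_ord0.
  rewrite big1 => [|k _]; last by rewrite mulr0.
  rewrite /weight_total big_seq big1 // => s; rewrite mem_permutations => /perm_size.
  by rewrite size_iota; case: s => [|? [|? [|? [|? s]]]] //= [eqn]; rewrite -eqn in lt_n4.
rewrite /weight_total -big_pseq.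
transitivity (\sum_(k < n.+2) \sum_(pi : 'S_n.+1)
   (if is_cluster sigma1423 (pseq pi) && (size (occs sigma1423 (pseq pi)) == k)
    then (-1) ^+ k else 0 : int)).
  apply: eq_bigr => k _; rewrite -big_mkcond sumr_const -mulr_natr natz.
  by congr (_ * Posz _); apply: eq_card => pi; rewrite inE.
rewrite exchange_big; apply: eq_bigr => pi _ /=.
have szp : size (pseq pi) = n.+1 by rewrite (perm_size (pseq_perm pi)) size_iota.
rewrite weight_cluster ?szp //; last by apply: leq_trans le_4n.
case: ifP => _ /=; last by rewrite big1.
have lt_k : (size (occs sigma1423 (pseq pi)) < n.+2)%N.
  have := count_size (occ_at sigma1423 (pseq pi)) (iota 0 (size (pseq pi))).
  by rewrite -size_filter size_iota ltnS [X in (_ <= X)%N]szp.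
rewrite (bigD1 (Ordinal lt_k)) //= eqxx big1 ?addr0 // => k.
by rewrite -val_eqE eq_sym /= => /negbTE->.
Qed.

(** * The ring of formal power series *)

Definition fpoly (n : nat) (f : fps) : {poly int} := \poly_(i < n) f i.

Lemma fmul_coef (f g : fps) n i : (i < n)%N -> fmul f g i = (fpoly n f * fpoly n g)`_i.
Proof.
move=> lt_in; rewrite coefM; apply: eq_bigr => j _.
by rewrite !coef_poly (leq_ltn_trans (leq_ord j) lt_in)
           (leq_ltn_trans (leq_subr j i) lt_in).
Qed.

Lemma fpsP (f g : fps) : (forall n, f n = g n) -> f = g.
Proof. exact: funext. Qed.

Lemma fmulC : commutative fmul.
Proof. by move=> f g; apply: fpsP => n; rewrite !(fmul_coef _ _ (ltnSn n)) mulrC. Qed.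

Lemma fmulA : associative fmul.
Proof.
move=> f g h; apply: fpsP => n.
transitivity ((fpoly n.+1 f * (fpoly n.+1 g * fpoly n.+1 h))`_n).
  rewrite coefM; apply: eq_bigr => j _.
  by rewrite coef_poly ltnS leq_ord (@fmul_coef _ _ n.+1) // ltnS leq_subr.
rewrite mulrA coefM; apply: eq_bigr => j _.
by rewrite [(fpoly _ h)`_ _]coef_poly ltnS leq_subr (@fmul_coef _ _ n.+1) // ltnS leq_ord.
Qed.

Definition fopp (f : fps) : fps := fun n => - f n.
Definition fzero : fps := fun _ => 0.

Lemma fmul1 : left_id fone fmul.
Proof.
move=> f; apply: fpsP => n; rewrite /fmul big_ord_recl /= mul1r subn0 big1 ?addr0 //.
by move=> i _; rewrite mul0r.
Qed.

Lemma fmulDl : left_distributive fmul fadd.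
Proof.
move=> f g h; apply: fpsP => n; rewrite /fadd /fmul -big_split /=.
by apply: eq_bigr => i _; rewrite mulrDl.
Qed.

HB.instance Definition _ := gen_eqMixin fps.
HB.instance Definition _ := gen_choiceMixin fps.

Lemma faddA : associative fadd.
Proof. by move=> f g h; apply: fpsP => n; rewrite /fadd addrA. Qed.
Lemma faddC : commutative fadd.
Proof. by move=> f g; apply: fpsP => n; rewrite /fadd addrC. Qed.
Lemma fadd0 : left_id fzero fadd.
Proof. by move=> f; apply: fpsP => n; rewrite /fadd add0r. Qed.
Lemma faddN : left_inverse fzero fopp fadd.
Proof. by move=> f; apply: fpsP => n; rewrite /fadd addNr. Qed.

HB.instance Definition _ := GRing.isZmodule.Build fps faddA faddC fadd0 faddN.

Lemma fone_neq0 : fone != 0 :> fps.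
Proof. by apply/eqP => /(congr1 (fun f : fps => f 0%N)). Qed.

HB.instance Definition _ :=
  GRing.Zmodule_isComNzRing.Build fps fmulA fmulC fmul1 fmulDl fone_neq0.

Lemma faddE (f g : fps) n : (f + g) n = f n + g n. Proof. by []. Qed.
Lemma foppE (f : fps) n : (- f) n = - f n. Proof. by []. Qed.
Lemma fmulE (f g : fps) n : (f * g) n = \sum_(i < n.+1) f i * g (n - i)%N. Proof. by []. Qed.
Lemma foneE n : (1 : fps) n = (n == 0%N)%:R. Proof. by []. Qed.

Lemma fsumE I (r : seq I) (P : pred I) (F : I -> fps) n :
  (\sum_(i <- r | P i) F i) n = \sum_(i <- r | P i) F i n.
Proof. exact: (big_morph (fun f : fps => f n)). Qed.

Lemma fpowE f k : fpow f k = f ^+ k.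
Proof. by elim: k => // k IHk; rewrite exprS /= IHk. Qed.

Lemma fmul_coef0 (f g : fps) : (f * g) 0%N = f 0%N * g 0%N.
Proof. by rewrite fmulE big_ord1. Qed.

Lemma fXmul0 (f : fps) : (fX * f) 0%N = 0.
Proof. by rewrite fmul_coef0 mul0r. Qed.

Lemma fXmulS (f : fps) n : (fX * f) n.+1 = f n.
Proof.
rewrite fmulE !big_ord_recl /= mul0r add0r mul1r subn1 /= big1 ?addr0 // => i _.
by rewrite mul0r.
Qed.

Lemma fmul_vanish (f g : fps) m p : (forall i, (i < m)%N -> f i = 0) ->
  (forall i, (i < p)%N -> g i = 0) -> forall i, (i < m + p)%N -> (f * g) i = 0.
Proof.
move=> f0 g0 n ltn; rewrite fmulE big1 // => i _.
have [lt_im|le_mi] := ltnP i m; first by rewrite f0 // mul0r.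
by rewrite g0 ?mulr0 //; have := ltn_ord i; lia.
Qed.

Lemma fprod_vanish (u : nat -> fps) m : (forall j, u j 0%N = 0) ->
  forall i, (i < m)%N -> (\prod_(j < m) u j) i = 0.
Proof.
move=> u0; elim: m => // m IHm i lt_im.
rewrite big_ord_recr /=; apply: (fmul_vanish IHm (p := 1)); last by rewrite addn1.
by case.
Qed.

Lemma fexp_vanish (f : fps) k i : f 0%N = 0 -> (i < k)%N -> (f ^+ k) i = 0.
Proof.
move=> f0 lt_ik; have := @fprod_vanish (fun=> f) k (fun=> f0) i lt_ik.
by rewrite prodr_const card_ord.
Qed.

Lemma fcompE (g f : fps) K n : f 0%N = 0 -> (n < K)%N ->
  fcomp g f n = \sum_(k < K) g k * (f ^+ k) n.
Proof.
move=> f0 ltnK; rewrite /fcomp.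
rewrite (big_ord_widen K (fun k => g k * fpow f k n)) // big_mkcond.
apply: eq_bigr => k _; rewrite fpowE; case: ltnP => // le_nk.
by rewrite fexp_vanish ?mulr0.
Qed.

Lemma fcomp_coef0 (g f : fps) : fcomp g f 0%N = g 0%N.
Proof. by rewrite /fcomp big_ord1 mulr1. Qed.

Lemma fcompD (g h f : fps) : fcomp (g + h) f = fcomp g f + fcomp h f.
Proof.
apply: fpsP => n; rewrite faddE /fcomp -big_split; apply: eq_bigr => i _.
by rewrite faddE mulrDl.
Qed.

Lemma fcomp1 (f : fps) : fcomp 1 f = 1.
Proof.
apply: fpsP => n; rewrite /fcomp big_ord_recl mul1r big1 ?addr0 // => i _.
by rewrite mul0r.
Qed.

Lemma fcompX (f : fps) : f 0%N = 0 -> fcomp fX f = f.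
Proof.
move=> f0; apply: fpsP => n; rewrite (@fcompE _ _ n.+2) // !big_ord_recl.
by rewrite mul0r add0r mul1r expr1 big1 ?addr0 // => i _; rewrite mul0r.
Qed.

Lemma fmulzE (f : fps) z n : (f *~ z) n = z * f n.
Proof.
have natE k : (f *+ k) n = (k : int) * f n.
  by elim: k => [|k IHk]; rewrite ?mulr0n ?mul0r // mulrS faddE IHk intS mulrDl mul1r.
case: z => k; first exact: natE.
by rewrite NegzE mulrNz foppE -pmulrn natE mulNr.
Qed.

(* Composition with [f] is a limit of evaluations of integer polynomials at [f],
   from which it inherits multiplicativity. *)
Definition fhorner (f : fps) (p : {poly int}) : fps := (map_poly intr p).[f].

Lemma fhornerE (f g : fps) (p : {poly int}) n : f 0%N = 0 ->
  (forall i, (i <= n)%N -> p`_i = g i) -> fhorner f p n = fcomp g f n.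
Proof.
move=> f0 pg; pose K := maxn n.+1 (size p).
rewrite /fhorner (@horner_coef_wide _ K); last first.
  by rewrite (leq_trans (size_poly _ _)) // leq_maxr.
rewrite fsumE (@fcompE _ _ K) ?leq_maxl //; apply: eq_bigr => i _.
rewrite coef_map /= mulrzl fmulzE.
by have [/pg-> // | lt_ni] := leqP i n; rewrite fexp_vanish ?mulr0.
Qed.

Lemma fcompM (g h f : fps) : f 0%N = 0 -> fcomp (g * h) f = fcomp g f * fcomp h f.
Proof.
move=> f0; apply: fpsP => n.
rewrite -(@fhornerE _ _ (fpoly n.+1 g * fpoly n.+1 h)) //; last first.
  by move=> i le_in; rewrite -fmul_coef.
rewrite /fhorner rmorphM hornerM !fmulE; apply: eq_bigr => i _; congr (_ * _).
  by apply: fhornerE => // j le_ji; rewrite coef_poly ltnS (leq_trans le_ji) // leq_ord.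
by apply: fhornerE => // j le_ji; rewrite coef_poly ltnS (leq_trans le_ji) // leq_subr.
Qed.

Lemma fcompXn (g f : fps) k : f 0%N = 0 -> fcomp (g ^+ k) f = fcomp g f ^+ k.
Proof.
move=> f0; elim: k => [|k IHk]; first exact: fcomp1.
by rewrite !exprS fcompM ?IHk.
Qed.

Lemma fcompA (g h f : fps) : h 0%N = 0 -> f 0%N = 0 ->
  fcomp (fcomp g h) f = fcomp g (fcomp h f).
Proof.
move=> h0 f0; apply: fpsP => n; rewrite [RHS](@fcompE _ _ n.+1) ?fcomp_coef0 //.
transitivity (\sum_(k < n.+1) \sum_(l < n.+1) g l * (h ^+ l) k * (f ^+ k) n).
  rewrite (@fcompE _ _ n.+1) //; apply: eq_bigr => k _.
  by rewrite (@fcompE _ _ n.+1) // mulr_suml.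
rewrite exchange_big; apply: eq_bigr => l _ /=.
rewrite -fcompXn // (@fcompE _ _ n.+1) // mulr_sumr; apply: eq_bigr => k _.
by rewrite mulrA.
Qed.

Lemma fXexpE k n : (fX ^+ k) n = (n == k)%:R.
Proof.
elim: k n => // k IHk n; rewrite exprS.
by case: n => [|n]; rewrite ?fXmul0 // fXmulS IHk eqSS.
Qed.

Lemma fcompr_fX (g : fps) : fcomp g fX = g.
Proof.
apply: fpsP => n; rewrite /fcomp big_ord_recr big1 => /= [|k _].
  by rewrite fpowE fXexpE eqxx mulr1 add0r.
by rewrite fpowE fXexpE gtn_eqF ?mulr0.
Qed.

Lemma finv1P (f : fps) : f 0%N = 0 -> (1 + f) * finv1 f = 1.
Proof.
move=> f0; pose geo : fps := fun k => (-1) ^+ k.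
have geoP : (1 + fX) * geo = 1.
  apply: fpsP => -[|n]; rewrite mulrDl mul1r faddE ?fXmul0 ?fXmulS ?addr0 //.
  by rewrite /geo exprS mulN1r addNr.
have -> : finv1 f = fcomp geo f by [].
by rewrite -{1}[f]fcompX // -{1}(fcomp1 f) -fcompD -fcompM // geoP fcomp1.
Qed.

Lemma BserP : (1 + fX ^+ 2) * Bser = fX.
Proof.
have -> : Bser = fX * finv1 (fX ^+ 2) by rewrite -fpowE.
by rewrite mulrCA finv1P ?mulr1 // expr2 fXmul0.
Qed.

Lemma Bser0 : Bser 0%N = 0.
Proof. exact: fXmul0. Qed.

Lemma Bj0 j : Bj j 0%N = 0.
Proof. by case: j => // j; rewrite /= fcomp_coef0 Bser0. Qed.

Lemma Bser_exp k i : (Bser ^+ k) (k + i)%N =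
  if odd i then 0 else (-1) ^+ i./2 * 'C(k + i./2 - 1, i./2)%:Z.
Proof.
have rec l n : (Bser ^+ l.+1) n.+1 = (Bser ^+ l) n - (fX * Bser ^+ l.+1) n.
  have := congr1 (fun f : fps => (f * Bser ^+ l) n.+1) BserP.
  rewrite /= -mulrA -exprS mulrDl mul1r faddE fXmulS expr2 -mulrA fXmulS => <-.
  by rewrite addrK.
elim: k i => [|k IHk] i.
  rewrite expr0 foneE add0n; case: i => [|[|i]] //=.
  by case: ifP => // _; rewrite bin_small ?mulr0 //; lia.
have [m] := ubnP i; elim: m i => // m IHm i lt_im.
rewrite addSn rec IHk; case: i lt_im => [|[|i]] lt_im.
- rewrite addn0; case: k {IHk IHm} => [|k]; rewrite ?fXmul0 ?fXmulS ?bin0 ?subr0 //=.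
  by rewrite fexp_vanish ?Bser0 // subr0 addn0 !bin0.
- by rewrite addn1 fXmulS fexp_vanish ?Bser0 ?subr0.
rewrite 2!addnS fXmulS -addSn IHm /=; last by lia.
rewrite negbK; case: ifP => _; first by rewrite subr0.
have -> : (k + i./2.+1 - 1 = k + i./2)%N by lia.
have -> : (k.+1 + i./2 - 1 = k + i./2)%N by lia.
have -> : (k.+1 + i./2.+1 - 1 = (k + i./2).+1)%N by lia.
by rewrite binS PoszD exprS; ring.
Qed.

Lemma fps_fixpoint (T : fps) : (1 + fX) * T = 1 + fX + fX * fcomp T Bser ->
  forall N M, (N <= M)%N -> fone N + \sum_(n < M) term n N = T N.
Proof.
move=> TP N M le_NM; pose u j : fps := Bj j * finv1 (Bj j).
have Tj j : fcomp T (Bj j) = 1 + u j * fcomp T (Bj j.+1).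
  have := congr1 (fun f => finv1 (Bj j) * fcomp f (Bj j)) TP.
  rewrite !fcompD (fcompM _ T) ?Bj0 // (fcompM fX) ?Bj0 // !fcompD fcomp1 fcompX ?Bj0 //.
  rewrite fcompA ?Bser0 ?Bj0 // -/(Bj j.+1) mulrA [finv1 _ * _]mulrC finv1P ?Bj0 // mul1r => ->.
  by rewrite mulrDr [finv1 _ * _]mulrC finv1P ?Bj0 // mulrA [finv1 _ * _]mulrC.
have termE n : term n = \prod_(j < n.+1) u j by [].
have -> : T = 1 + \sum_(n < M) term n + term M * fcomp T (Bj M.+1).
  elim: M {le_NM} => [|M {1}->].
    by rewrite big_ord0 addr0 termE big_ord1 -Tj fcompr_fX.
  rewrite (Tj M.+1) big_ord_recr /= mulrDr mulr1 !addrA [term M.+1]termE big_ord_recr -termE.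
  by rewrite mulrA.
rewrite !faddE fsumE [X in _ = _ + X](_ : _ = 0) ?addr0 //.
apply: (@fmul_vanish _ _ M.+1 0); rewrite ?addn0 // => i.
by rewrite termE; apply: fprod_vanish => j; rewrite /u fmul_coef0 Bj0 mul0r.
Qed.

Lemma big_even (R : nmodType) m (F : nat -> R) :
  \sum_(i < m.*2) (if odd i then 0 else F i) = \sum_(r < m) F r.*2.
Proof.
elim: m => [|m IHm]; first by rewrite !big_ord0.
by rewrite doubleS !big_ord_recr IHm /= odd_double addr0.
Qed.

Lemma fcomp_Bser_Tcoef n : fcomp (Tcoef sigma1423) Bser n.+1 =
  \sum_(r < n.+3) (-1) ^+ r * (weight_total (n.+1 - r.*2) * 'C(n - r, r)%:Z).
Proof.
pose F i : int := (-1) ^+ i./2 * (weight_total (n.+1 - i) * 'C(n - i./2, i./2)%:Z).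
transitivity (\sum_(i < n.+2) if odd i then 0 else F i).
  rewrite /fcomp (reindex_inj rev_ord_inj); apply: eq_bigr => i _ /=.
  rewrite fpowE subSS; have le_i : (i <= n.+1)%N by rewrite -ltnS.
  have := Bser_exp (n.+1 - i) i; rewrite subnK // => ->; rewrite /F.
  case: ifP => [_|even_i]; first by rewrite mulr0.
  have [i_n|i_n] := eqVneq (i : nat) n.+1.
    rewrite i_n in even_i *; rewrite subnn weight_total0 mul0r mulr0.
    by rewrite bin_small ?mulr0 //; lia.
  rewrite Tcoef_weight; last by lia.
  by rewrite (_ : n.+1 - i + i./2 - 1 = n - i./2)%N; [rewrite mulrCA | lia].
transitivity (\sum_(i < n.+3.*2) if odd i then 0 else F i); last first.
  by rewrite big_even; apply: eq_bigr => r _; rewrite /F doubleK.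
rewrite (big_ord_widen n.+3.*2 (fun i => if odd i then 0 else F i)); last by lia.
rewrite big_mkcond; apply: eq_bigr => i _; case: ltnP => // le_i.
by rewrite /F (eqP (_ : n.+1 - i == 0)%N) ?weight_total0 ?mul0r ?mulr0 ?if_same //; lia.
Qed.

Lemma Tcoef_functional (T := Tcoef sigma1423 : fps) :
  (1 + fX) * T = 1 + fX + fX * fcomp T Bser.
Proof.
apply: fpsP => -[|[|n]]; rewrite mulrDl mul1r !faddE ?fXmul0 ?fXmulS //.
  by rewrite fcomp_coef0 /T Tcoef_weight // weight_total1.
rewrite add0r /T fcomp_Bser_Tcoef !Tcoef_weight // weight_total_rec.
rewrite [RHS]big_ord_recl /= mul1r subn0 bin0 mulr1 addrC; congr (_ + _).
by apply: eq_bigr => r _; rewrite /bump add1n (_ : n.+1 - r.+1 - 1 = n - r.+1)%N //; lia.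
Qed.

(* The series 1 + sum_{n>=0} prod_{j=0}^n B_j/(1+B_j) converges x-adically
   (each coefficient of the partial sums is eventually constant) and its sum
   is T(x). *)
Theorem theorem2p4 : forall N : nat, exists M0 : nat, forall M : nat, (M0 <= M)%N ->
  fone N + \sum_(n < M) term n N = Tcoef sigma1423 N.
Proof.
by move=> N; exists N => M; apply: fps_fixpoint; apply: Tcoef_functional.
Qed.
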